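(* Let $N \in \mathbb{N}$, let $\mathcal{X} \subset \mathbb{C}^N$ be non-empty and $\mathcal{Y} \subset \mathbb{C}$, and let $\mathcal{H}$ be a separable reproducing kernel Hilbert space of functions $\mathcal{X} \to \mathcal{Y}$ generated by the reproducing kernel $\xi : \mathcal{X} \times \mathcal{X} \to \mathbb{C}$. Let $\{\varphi_j\}_{j=0}^{\infty} \subset \mathcal{H}$ be a fixed complete orthonormal system in $\mathcal{H}$, and for $D \in \mathbb{N}$ put $$\xi_D(x,t) := \sum_{j=0}^{D-1} \varphi_j(x)\,\overline{\varphi_j(t)} \qquad (x,t \in \mathcal{X}).$$ Then for any $x, t \in \mathcal{X}$ and any $D \in \mathbb{N}$, $$\left| \xi(x,t) - \xi_D(x,t) \right| \leq \left( \sum_{j=D}^{\infty} |\varphi_j(x)|^2 \right)^{1/2} \left( \sum_{j=D}^{\infty} |\varphi_j(t)|^2 \right)^{1/2}.$$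
   Context: A reproducing kernel Hilbert space (RKHS) on a non-empty set $\mathcal{X}$ is a complex Hilbert space $\mathcal{H}$ of functions on $\mathcal{X}$ with values in $\mathbb{C}$, with inner product $\langle\cdot,\cdot\rangle_{\mathcal{H}}$ (linear in the first argument), such that for every $t \in \mathcal{X}$ the evaluation functional $f \mapsto f(t)$ is bounded. Its reproducing kernel is $\xi(x,t) := \xi_t(x)$, where $\xi_t \in \mathcal{H}$ is the unique element with $f(t) = \langle f, \xi_t\rangle_{\mathcal{H}}$ for all $f \in \mathcal{H}$. A complete orthonormal system is an orthonormal system whose linear span is dense in $\mathcal{H}$ (a Hilbert basis). *)

(* Defs.v *)
From HB Require Import structures.
From mathcomp Require Import all_boot all_order all_algebra.
From mathcomp Require Import complex.
From mathcomp Require Import all_classical all_reals all_analysis.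

Set Implicit Arguments.
Unset Strict Implicit.
Unset Printing Implicit Defensive.

Import Order.TTheory GRing.Theory Num.Theory.
Import numFieldNormedType.Exports.

Local Open Scope classical_set_scope.
Local Open Scope ring_scope.

(* A complex reproducing kernel Hilbert space of functions on T: a Banach space
   whose norm comes from an inner product (linear in its first argument),
   whose vectors are identified with functions T -> R[i] through an injective
   linear map, and whose point evaluations are bounded. *)
Record rkhs (R : realType) (T : Type) := RKHS {
  rkhs_space :> completeNormedModType R[i] ;
  rkhs_dot : {dot rkhs_space for (@Num.conj R[i])} ;
  rkhs_normE : forall f : rkhs_space, `|f| ^+ 2 = rkhs_dot f f ;
  rkhs_fun : {linear rkhs_space -> (T -> R[i])} ;
  rkhs_fun_inj : injective rkhs_fun ;
  rkhs_eval_bounded : forall t : T, exists M : R[i],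
    forall f : rkhs_space, `|rkhs_fun f t| <= M * `|f| }.

Arguments rkhs_dot {R T r}.
Arguments rkhs_fun {R T r}.

Definition reproducing_kernel (R : realType) (T : Type) (H : rkhs R T)
    (xi : T -> T -> R[i]) : Prop :=
  exists k : T -> H,
    (forall (f : H) (t : T), rkhs_fun f t = rkhs_dot f (k t)) /\
    (forall x t : T, xi x t = rkhs_fun (k t) x).

Definition separable (T : topologicalType) : Prop :=
  exists S : set T, countable S /\ dense S.

Definition linear_span (K : pzRingType) (V : lmodType K) (u : nat -> V) :
    set V :=
  [set v | exists (n : nat) (c : nat -> K), v = \sum_(j < n) c j *: u j].

Definition complete_orthonormal_system (R : realType) (T : Type)
    (H : rkhs R T) (phi : nat -> H) : Prop :=
  (forall i j : nat, rkhs_dot (phi i) (phi j) = (i == j)%:R) /\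
  dense (linear_span phi).

Definition truncated_kernel (R : realType) (T : Type) (H : rkhs R T)
    (phi : nat -> H) (D : nat) (x t : T) : R[i] :=
  \sum_(j < D) rkhs_fun (phi j) x * Num.conj (rkhs_fun (phi j) t).

(* The modulus as an element of R; the norm of R[i] takes values in R[i]. *)
Definition modulus (R : realType) (z : R[i]) : R := ComplexField.Normc.normc z.

(* Partial sums, over D <= j < n, of the series with terms |phi_j(x)|^2. *)
Definition tail_sums (R : realType) (T : Type) (H : rkhs R T)
    (phi : nat -> H) (D : nat) (x : T) (n : nat) : R :=
  \sum_(D <= j < n) modulus (rkhs_fun (phi j) x) ^+ 2.

(* Main.v *)
(** Let [k_x] represent evaluation at [x], and let [r_D] be the projection onto
    the orthogonal complement of the first [D] vectors [phi_j]. Then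
    [xi x t - xi_D x t = <r_D k_t, r_D k_x>], which Cauchy-Schwarz bounds by
    [|r_D k_t| * |r_D k_x|]. By Pythagoras, the sum of [|phi_j x|^2] over
    [D <= j < n] is [|r_D k_x|^2 - |r_n k_x|^2], and the last term tends to [0]
    since [r_n k_x] minimizes the distance from [k_x] to the span of the first
    [n] vectors, and the union of these spans is dense. *)

Require Import Defs.
From HB Require Import structures.
From mathcomp Require Import all_boot all_order all_algebra.
From mathcomp Require Import complex.
From mathcomp Require Import all_classical all_reals all_analysis.

Set Implicit Arguments.
Unset Strict Implicit.
Unset Printing Implicit Defensive.

Import Order.TTheory GRing.Theory Num.Theory.
Import numFieldNormedType.Exports.

Local Open Scope classical_set_scope.
Local Open Scope ring_scope.

Section DotTheory.
Variables (C : numClosedFieldType) (U : lmodType C).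
Variable form : {dot U for (@Num.conj C)}.

Local Notation "''[' u , v ]" := (form u%R v%R) : ring_scope.
Local Notation "''[' u ]" := '[u, u]%R : ring_scope.

Lemma dotC u v : '[u, v] = Num.conj '[v, u].
Proof. by rewrite hermC /= expr0 mul1r. Qed.

(* The library version [CauchySchwarz] requires finite dimension. *)
Lemma cauchy_schwarz_lmod u v : `|'[u, v]| ^+ 2 <= '[u] * '[v].
Proof.
have [->|v0] := eqVneq v 0; first by rewrite !linear0r normr0 expr0n.
have vp : 0 < '[v] by rewrite dnorm_gt0.
(* [a *: v] is the orthogonal projection of [u] onto the line through [v]. Dropping the squared norm
   of the remainder [u - a *: v] from Pythagoras gives the bound. *)
set a := '[u, v] / '[v].
have orth : '[u - a *: v, a *: v] = 0.
  rewrite linearZr_LR linearBl linearZl_LR /= /a mulfVK ?gt_eqF//.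
  by rewrite subrr mulr0.
have : '[u] = '[u - a *: v] + '[a *: v].
  by rewrite -(hnormDd orth) subrK.
rewrite dnormZ => ->.
rewrite mulrDl.
have -> : `|a| ^+ 2 * '[v] * '[v] = `|'[u, v]| ^+ 2.
  by rewrite -mulrA -expr2 -{1}(gtr0_norm vp) -exprMn -normrM mulfVK ?gt_eqF.
by rewrite lerDr mulr_ge0 ?dnorm_ge0.
Qed.

Variable e : nat -> U.
Hypothesis e_orthonormal : forall i j, '[e i, e j] = (i == j)%:R.

Definition fourier_sum n u := \sum_(j < n) '[u, e j] *: e j.

Definition residual n u := u - fourier_sum n u.

Lemma residual_dotl n u v :
  '[residual n u, v] = '[u, v] - \sum_(j < n) '[u, e j] * '[e j, v].
Proof.
rewrite linearBl linear_sumlz; congr (_ - _).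
by apply: eq_bigr => j _; rewrite linearZl_LR.
Qed.

Lemma residual_orthogonal n u (c : nat -> C) :
  '[residual n u, \sum_(i < n) c i *: e i] = 0.
Proof.
rewrite linear_sumr big1 // => i _; rewrite linearZr_LR /= residual_dotl.
rewrite (bigD1 i) //= e_orthonormal eqxx mulr1 big1 => [|j ji].
  by rewrite addr0 subrr mulr0.
by rewrite e_orthonormal (inj_eq val_inj) (negPf ji) mulr0.
Qed.

(** The Fourier sum subtracted from [v] lies in the span to which [residual n u] is orthogonal, so
    the right argument may be replaced by [v]. *)
Lemma residual_dot n u v : '[residual n u, residual n v] =
  '[u, v] - \sum_(j < n) '[u, e j] * '[e j, v].
Proof.
have /= orth := residual_orthogonal n u (fun j => '[v, e j]).
rewrite [X in '[_, X]]/residual /fourier_sum linearBr /= orth.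
by rewrite subr0 residual_dotl.
Qed.

Lemma residual_dnorm n u :
  '[residual n u] = '[u] - \sum_(j < n) `|'[u, e j]| ^+ 2.
Proof.
rewrite residual_dot; congr (_ - _); apply: eq_bigr => j _.
by rewrite [X in _ * X]dotC normCK.
Qed.

(** The error of any combination is the residual plus a vector of the span; these two are
    orthogonal, so Pythagoras applies. *)
Lemma residual_dnorm_min n u (c : nat -> C) :
  '[residual n u] <= '[u - \sum_(j < n) c j *: e j].
Proof.
have -> : u - \sum_(j < n) c j *: e j =
    residual n u + \sum_(j < n) ('[u, e j] - c j) *: e j.
  rewrite /residual /fourier_sum -addrA; congr (_ + _).
  under [X in _ = _ + X]eq_bigr do rewrite scalerBl.
  rewrite sumrB.
  by rewrite addrA addNr add0r.
have /= orth := residual_orthogonal n u (fun j => '[u, e j] - c j).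
by rewrite (hnormDd orth) lerDl dnorm_ge0.
Qed.

End DotTheory.

Lemma normr_modulus (R : realType) (z : R[i]) : `|z| = (modulus z)%:C%C.
Proof. by []. Qed.

Section Tails.
Variables (R : realType) (T : Type) (H : rkhs R T).
Variables (phi : nat -> H) (phi_cons : complete_orthonormal_system phi).

(** Taking the real part moves this nonnegative number from [R[i]] to [R], where the tail sums and
    their limits live. *)
Definition residual_energy (n : nat) (u : H) : R :=
  complex.Re (rkhs_dot (residual rkhs_dot phi n u)
                       (residual rkhs_dot phi n u)).

Lemma residual_energyE n u :
  rkhs_dot (residual rkhs_dot phi n u) (residual rkhs_dot phi n u) =
  (residual_energy n u)%:C%C.
Proof. by rewrite /residual_energy RRe_real// ger0_real// dnorm_ge0. Qed.

Lemma residual_energy_ge0 n u : 0 <= residual_energy n u.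
Proof. by rewrite -lecR -residual_energyE dnorm_ge0. Qed.

(** Density puts some finite combination within [eps] of [u]; its length is the required [n], as the
    residual is at least as short as that error. *)
Lemma residual_energy_small u (eps : R) : 0 < eps ->
  exists n, residual_energy n u < eps ^+ 2.
Proof.
move=> e0; have ec0 : 0 < eps%:C%C :> R[i] by rewrite ltcR.
have [||v [uv [n [c vE]]]] := phi_cons.2 (ball u eps%:C%C).
- by exists u; exact: ballxx.
- exact: ball_open.
exists n; rewrite -ltcR -residual_energyE.
apply: le_lt_trans (residual_dnorm_min phi_cons.1 n u c) _.
rewrite -vE -rkhs_normE rmorphXn /=.
by move: uv; rewrite -ball_normE /= => uv; rewrite ltrXn2r// nnegrE ?normr_ge0 ?ltW.
Qed.

Variables (k : H) (x : T).
Hypothesis k_reproducing : forall f : H, rkhs_fun f x = rkhs_dot f k.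

Lemma tail_sums_residual D n : (D <= n)%N ->
  tail_sums phi D x n = residual_energy D k - residual_energy n k.
Proof.
move=> Dn; apply: (@complexI R).
rewrite [RHS]rmorphB /= -!residual_energyE !(residual_dnorm phi_cons.1).
rewrite opprB addrC subrKA.
rewrite -!(big_mkord predT (fun j => `|rkhs_dot k (phi j)| ^+ 2)).
rewrite (big_cat_nat _ Dn) //= addrAC subrr add0r rmorph_sum /=.
apply: eq_bigr => j _; rewrite rmorphXn /= -normr_modulus.
(* The value of [phi j] at [x] is the conjugate of the Fourier coefficient of [k], hence has the
   same modulus. *)
by rewrite k_reproducing dotC norm_conjC.
Qed.

Lemma tail_sums_nondecreasing D : nondecreasing_seq (tail_sums phi D x).
Proof.
apply/nondecreasing_seqP => n; rewrite /tail_sums.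
(* If [n < D], then [n.+1 <= D] and both sums are empty. *)
have [Dn|nD] := leqP D n; last by rewrite !big_geq// ltnW.
by rewrite big_nat_recr//= lerDl sqr_ge0.
Qed.

Lemma tail_sums_bounded D n : tail_sums phi D x n <= residual_energy D k.
Proof.
have [Dn|nD] := leqP D n.
  by rewrite tail_sums_residual// gerBl residual_energy_ge0.
by rewrite /tail_sums big_geq ?residual_energy_ge0// ltnW.
Qed.

Lemma tail_sums_cvg D : cvgn (tail_sums phi D x).
Proof.
apply: nondecreasing_is_cvgn; first exact: tail_sums_nondecreasing.
by exists (residual_energy D k) => _ [n _ <-]; exact: tail_sums_bounded.
Qed.

Lemma residual_energy_nonincreasing m n :
  (m <= n)%N -> residual_energy n k <= residual_energy m k.
Proof.
move=> mn; rewrite -subr_ge0 -tail_sums_residual// /tail_sums.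
by apply: sumr_ge0 => j _; rewrite sqr_ge0.
Qed.

Lemma residual_energy_le_lim D :
  residual_energy D k <= limn (tail_sums phi D x).
Proof.
apply/ler_addgt0Pr => e e0.
have [|n] := @residual_energy_small k (Num.sqrt e); first by rewrite sqrtr_gt0.
rewrite sqr_sqrtr ?(ltW e0)// => small_n.
have Dm := leq_maxl D n.
rewrite -[leLHS](subrK (residual_energy (maxn D n) k)) -tail_sums_residual//.
apply: lerD.
  by apply: nondecreasing_cvgn_le;
    [exact: tail_sums_nondecreasing | exact: tail_sums_cvg].
by rewrite (le_trans (residual_energy_nonincreasing (leq_maxr D n)))// ltW.
Qed.

End Tails.

Theorem mainTheorem1 (R : realType) (N : nat) (X : set 'rV[R[i]]_N)
    (X_neq0 : X !=set0) (Y : set R[i])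
    (H : rkhs R X) (H_values : forall (f : H) (x : X), Y (rkhs_fun f x))
    (H_separable : separable H)
    (xi : X -> X -> R[i]) (xi_kernel : reproducing_kernel H xi)
    (phi : nat -> H) (phi_cons : complete_orthonormal_system phi)
    (x t : X) (D : nat) :
  cvgn (tail_sums phi D x) /\
  cvgn (tail_sums phi D t) /\
  modulus (xi x t - truncated_kernel phi D x t) <=
    Num.sqrt (limn (tail_sums phi D x)) * Num.sqrt (limn (tail_sums phi D t)).
Proof.
have [k [kE xiE]] := xi_kernel.
split; first exact: (tail_sums_cvg phi_cons (kE^~ x)).
split; first exact: (tail_sums_cvg phi_cons (kE^~ t)).
(* The points swap places because [xi x t] is the value of [k t] at [x], that is, the inner product
   of [k t] with [k x]. *)
have -> : xi x t - truncated_kernel phi D x t =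
    rkhs_dot (residual rkhs_dot phi D (k t)) (residual rkhs_dot phi D (k x)).
  rewrite (residual_dot phi_cons.1) xiE kE; congr (_ - _).
  by apply: eq_bigr => j _; rewrite !kE -dotC mulrC.
rewrite -sqrtrM; last first.
  exact: le_trans (residual_energy_ge0 _ _ _)
    (residual_energy_le_lim phi_cons (kE^~ x) D).
(* Writing the modulus as the root of its square reduces the claim to squares, the form in which
   Cauchy-Schwarz was proved. *)
apply: le_trans (ler_norm _) _; rewrite -sqrtr_sqr ler_wsqrtr// mulrC.
apply: (@le_trans _ _ (residual_energy phi D (k t) * residual_energy phi D (k x))).
  rewrite -lecR rmorphXn rmorphM /= -normr_modulus -!residual_energyE.
  exact: cauchy_schwarz_lmod.
by apply: ler_pM; rewrite ?residual_energy_ge0//;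
  [exact: residual_energy_le_lim (kE^~ t) D
  |exact: residual_energy_le_lim (kE^~ x) D].
Qed.
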